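(* Let $h:\mathbb{N}\to\mathbb{R}$ be a function with $h(1)\in[0,1]$ satisfying, for all integers $k\ge 2$: (A1) $h(k+1)\le h(k)$; (A2) $0\le h(k)\le 1/(k-1+1/k)$; (A3) $h(k+1)\le 1-(k-1)h(k)$. Then for every hypergraph $H=(V,E)$, the function $g(e)=h(|e|)$ is good for $H$. In particular, for every hypergraph $H$ and every fractional matching $x$ of $H$ there is a probability distribution over matchings $M$ of $H$ such that $\Pr(e\in M)\ge h(|e|)\,x(e)$ for every edge $e$.
   Context: A hypergraph $H=(V,E)$ consists of a finite vertex set $V$ and a finite set $E$ of nonempty subsets of $V$ (edges). A matching is a set of pairwise disjoint edges. For an edge $e$, $N(e)=\{f\in E: f\neq e,\ f\cap e\neq\emptyset\}$. A fractional matching of $H$ is a function $x:E\to[0,1]$ with $\sum_{e\ni v}x(e)\le 1$ for every $v\in V$; it is basic if it is an extreme point of the polytope of fractional matchings of $H$. Given $g:E\to\mathbb{R}$, a basic fractional matching $x$ of $H$ is stuck for $g$ if for every $e\in E$, $\sum_{f\in N(e)}g(f)x(f)>1-g(e)x(e)$. A subgraph of $H$ is a hypergraph $H'=(V,E')$ with $E'\subseteq E$ (neighborhoods and fractional matchings taken in $H'$, $g$ restricted to $E'$); it is non-empty if $E'\neq\emptyset$. $g$ is good for $H$ if no non-empty subgraph of $H$ has a basic fractional matching that is stuck for $g$. *)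

(* Defs.v *)
From HB Require Import structures.
From mathcomp Require Import all_boot all_order all_algebra.
From mathcomp Require Import reals.
Set Implicit Arguments.
Unset Strict Implicit.
Unset Printing Implicit Defensive.
Import Order.TTheory GRing.Theory Num.Theory.
Local Open Scope ring_scope.

Record hypergraph (V : finType) := Hypergraph {
  edges : {set {set V}};
  edges_nonempty : set0 \notin edges
}.

Definition subgraph (V : finType) (H' H : hypergraph V) : Prop :=
  edges H' \subset edges H.

Definition matching (V : finType) (H : hypergraph V) (M : {set {set V}}) : bool :=
  (M \subset edges H) && trivIset M.

Definition nbhd (V : finType) (H : hypergraph V) (e : {set V}) : {set {set V}} :=
  [set f in edges H | (f != e) && (f :&: e != set0)].

(* A function E -> R is encoded as a finite function on all subsets of V that
   vanishes off E, so that equality of encodings is equality of functions on E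
   and the extreme points below are those of the polytope in R^E. *)
Definition fractional_matching (R : realType) (V : finType) (H : hypergraph V)
    (x : {ffun {set V} -> R}) : Prop :=
  [/\ forall e, e \notin edges H -> x e = 0,
      forall e, e \in edges H -> 0 <= x e <= 1
    & forall v : V, \sum_(e in edges H | v \in e) x e <= 1].

Definition extreme_point (R : realType) (I : finType)
    (P : {ffun I -> R} -> Prop) (x : {ffun I -> R}) : Prop :=
  P x /\ forall (y z : {ffun I -> R}) (t : R), P y -> P z -> 0 < t < 1 ->
    (forall i, x i = t * y i + (1 - t) * z i) -> y = x /\ z = x.

Definition basic_fractional_matching (R : realType) (V : finType)
    (H : hypergraph V) (x : {ffun {set V} -> R}) : Prop :=
  extreme_point (fractional_matching H) x.

(* Only the values of g on edges are used, so restricting g to a subgraph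
   amounts to changing H. *)
Definition stuck (R : realType) (V : finType) (H : hypergraph V)
    (g : {set V} -> R) (x : {ffun {set V} -> R}) : Prop :=
  basic_fractional_matching H x /\
  forall e, e \in edges H -> \sum_(f in nbhd H e) g f * x f > 1 - g e * x e.

Definition good (R : realType) (V : finType) (H : hypergraph V)
    (g : {set V} -> R) : Prop :=
  forall H' : hypergraph V, subgraph H' H -> edges H' != set0 ->
    ~ exists x : {ffun {set V} -> R}, stuck H' g x.

Definition matching_distribution (R : realType) (V : finType)
    (H : hypergraph V) (p : {ffun {set {set V}} -> R}) : Prop :=
  [/\ forall M, 0 <= p M,
      forall M, ~~ matching H M -> p M = 0
    & \sum_(M : {set {set V}}) p M = 1].

Definition pr_edge (R : realType) (V : finType)
    (p : {ffun {set {set V}} -> R}) (e : {set V}) : R :=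
  \sum_(M : {set {set V}} | e \in M) p M.

(* Main.v *)
(** Call x independent if no nonzero z supported in the support of x has all its
    vertex sums equal to 0.  A packing that is not independent is a proper convex
    combination of two packings of smaller support, so extreme points are
    independent.

    An independent x <> 0 has an edge e with [\sum_(f meets e) h |f| x f <= 1].
    Otherwise let k be the least size of an edge in the support, E the support
    edges of size k, U their union, and d v the x-weight of E at v.  For e in E,
    bounding the edges outside E by h (k + 1) turns "the sum exceeds 1" into
    [\sum_(v in e) (1 - d v + x e) < 1], via (A2) and (A3).  Summed over E this
    yields |U| < |E|, as every v in U contributes at least 1; hence the vertex
    constraints at U have a nonzero solution supported on E, contradicting
    independence.

    No LP duality is needed for the distribution: by induction on the support, x
    carries a random matching M with Pr(e \in M) = h |e| x e exactly.  If x is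
    not independent, mix the laws of two smaller packings.  Otherwise take e as
    above and a law for x with e removed; by the union bound M misses all
    neighbours of e with probability at least h |e| x e, and conditionally on
    that event e is added with the right probability. *)
Require Import Defs.
From HB Require Import structures.
From mathcomp Require Import all_boot all_order all_algebra.
From mathcomp Require Import boolp reals.
From mathcomp Require Import lra ring.
Set Implicit Arguments.
Unset Strict Implicit.
Unset Printing Implicit Defensive.
Import Order.TTheory GRing.Theory Num.Theory.
Local Open Scope ring_scope.

Section Packings.
Variables (R : realType) (V : finType).
Implicit Types (x y z : {ffun {set V} -> R}) (e f : {set V}) (v : V).

(** * Packings and directions that preserve vertex sums *)

Definition packing x :=
  [/\ x set0 = 0, forall e, 0 <= x e & forall v, \sum_(e : {set V} | v \in e) x e <= 1].

Definition supp x : {set {set V}} := [set e | x e != 0].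

Definition circulation x z :=
  (forall e, x e = 0 -> z e = 0) /\ forall v, \sum_(e : {set V} | v \in e) z e = 0.

(** Equivalently, the incidence vectors of the sets in [supp x] are linearly independent. *)
Definition independent x := forall z, circulation x z -> z = 0.

Lemma circulationN x z : circulation x z -> circulation x (- z).
Proof.
move=> [zx zv]; split=> [e /zx ze|v]; first by rewrite ffunE ze oppr0.
under eq_bigr do rewrite ffunE.
by rewrite sumrN zv oppr0.
Qed.

(** A nonnegative [z] with zero vertex sums vanishes on every set that has a vertex; on the empty
    set it vanishes because [x] does. *)
Lemma circulation_neg x z :
  packing x -> circulation x z -> z != 0 -> exists e, z e < 0.
Proof.
move=> [x0 _ _] [zx zv] zN0; apply/existsP; apply: contraNT zN0 => /existsPn zge.
have {}zge e : 0 <= z e by rewrite leNgt.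
apply/eqP/ffunP => e; rewrite ffunE.
have [->|[v ve]] := set_0Vmem e; first exact: zx.
have /eqP := zv v; rewrite psumr_eq0 // => /allP/(_ e (mem_index_enum _)).
by rewrite ve => /eqP.
Qed.

(** The ratio test of the simplex method: coordinate [e] with [z e < 0] reaches 0 after the step
    [r e]. The least such step keeps all coordinates nonnegative, and its minimiser leaves the
    support. *)
Lemma packing_move x z : packing x -> circulation x z -> z != 0 ->
  exists c, [/\ 0 < c, packing (x + [ffun e => c * z e])
              & supp (x + [ffun e => c * z e]) \proper supp x].
Proof.
move=> px cz zN0; have [e0 ze0] := circulation_neg px cz zN0.
case: px cz => [x0 xge xv] [zx zv].
pose r e := x e / - z e.
case: (@arg_minP _ _ _ e0 (fun e => z e < 0) r ze0) => e1 ze1 min_e1.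
have pos e : z e < 0 -> 0 < x e.
  by move=> ze; rewrite lt_def xge andbT; apply: contraTN ze => /eqP/zx ->; rewrite ltxx.
exists (r e1); have r_gt0 : 0 < r e1 by rewrite divr_gt0 ?pos ?oppr_gt0.
split=> //.
  split=> [|e|v].
  - by rewrite !ffunE x0 zx ?mulr0 ?addr0.
  - rewrite !ffunE; have [ze|ze] := ltP (z e) 0; last by rewrite addr_ge0 // mulr_ge0 // ltW.
    have := min_e1 e ze; rewrite /r (ler_pdivlMr _ _ (_ : 0 < - z e)) ?oppr_gt0 //.
    by rewrite mulrN -subr_ge0 opprK.
  - under eq_bigr do rewrite !ffunE.
    by rewrite big_split /= -mulr_sumr zv mulr0 addr0.
apply/properP; split.
  apply/subsetP => e; rewrite !inE !ffunE; apply: contraNN => /eqP xe.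
  by rewrite xe zx ?mulr0 ?addr0.
exists e1; rewrite inE; first by rewrite gt_eqF ?pos.
by rewrite !ffunE /r invrN mulrN mulNr divfK ?subrr ?eqxx // lt_eqF.
Qed.

Lemma independent_or_split x : packing x -> independent x \/
  exists y1 y2 t, [/\ 0 < t < 1, packing y1 /\ packing y2,
    supp y1 \proper supp x /\ supp y2 \proper supp x
    & forall e, x e = t * y1 e + (1 - t) * y2 e].
Proof.
move=> px; have [ind|] := EM (independent x); [by left|right].
have [z [cz zN0]] : exists z, circulation x z /\ z != 0.
  apply: contrapT => no_z; apply: b => z cz; apply/eqP.
  by apply: contrapT => /negP zN0; apply: no_z; exists z.
have [c [c0 pc sc]] := packing_move px cz zN0.
have [|d [d0 pd sd]] := packing_move px (circulationN cz); first by rewrite oppr_eq0.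
have cd0 : 0 < c + d by rewrite addr_gt0.
(* With this weight [t], [t * c = (1 - t) * d], so the displacements along [z] and [- z] cancel. *)
exists (x + [ffun e => c * z e]), (x + [ffun e => d * (- z) e]), (d / (c + d)).
split=> // [|e].
  by rewrite divr_gt0 //= ltr_pdivrMr // mul1r ltrDr.
rewrite !ffunE; field; exact: lt0r_neq0.
Qed.

(** There are [#|E|] unknowns and only [#|U|] equations, so the incidence matrix has a nonzero left
    kernel. *)
Lemma kernel_of_card (E : {set {set V}}) (U : {set V}) : (#|U| < #|E|)%N ->
  exists2 z : {ffun {set V} -> R}, z != 0 & (forall e, e \notin E -> z e = 0) /\
    forall v, v \in U -> \sum_(e : {set V} | v \in e) z e = 0.
Proof.
move=> UE.
pose edge (i : 'I_#|E|) : {set V} := enum_val i.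
pose A : 'M[R]_(#|E|, #|U|) := \matrix_(i, j) (enum_val j \in edge i)%:R.
have : kermx A != 0.
  rewrite -mxrank_eq0 mxrank_ker subn_eq0 -ltnNge.
  exact: leq_ltn_trans (rank_leq_col A) UE.
case/rowV0Pn => u /sub_kermxP uA u0.
(* The kernel vector extended by 0 outside [E]; at most one term of the sum is nonzero. *)
pose z : {ffun {set V} -> R} := [ffun e => \sum_(i < #|E|) u 0 i *+ (edge i == e)].
have zE i : z (edge i) = u 0 i.
  rewrite ffunE (bigD1 i) //= eqxx big1 ?addr0 // => j ji.
  by rewrite (inj_eq enum_val_inj) (negbTE ji).
exists z.
  apply: contraNneq u0 => z0; apply/eqP/rowP => i.
  by rewrite -zE z0 ffunE mxE.
split=> [e eE|v vU].
  rewrite ffunE big1 // => i _; case: eqP => // ie.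
  by move: eE; rewrite -ie enum_valP.
transitivity ((u *m A) 0 (enum_rank_in vU v)); last by rewrite uA mxE.
rewrite mxE.
under eq_bigr do rewrite ffunE.
rewrite exchange_big /=; apply: eq_bigr => i _.
rewrite !mxE enum_rankK_in //.
have [vi|vi] := boolP (v \in edge i).
  rewrite mulr1 (bigD1 (edge i)) //= eqxx big1 ?addr0 // => e /andP[_].
  by rewrite eq_sym => /negbTE ->.
by rewrite mulr0 big1 // => e ve; case: eqP => // ie; rewrite ie ve in vi.
Qed.

(** * Bounds on the size function *)

Variable h : nat -> R.
Hypothesis h1 : 0 <= h 1%N <= 1.
Hypothesis A1 : forall k : nat, (2 <= k)%N -> h k.+1 <= h k.
Hypothesis A2 : forall k : nat, (2 <= k)%N -> 0 <= h k <= 1 / (k%:R - 1 + 1 / k%:R).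
Hypothesis A3 : forall k : nat, (2 <= k)%N -> h k.+1 <= 1 - (k%:R - 1) * h k.

Lemma h_ge0 k : (0 < k)%N -> 0 <= h k.
Proof. by case: k => // -[_|k _]; [case/andP: h1|case/andP: (A2 (isT : (1 < k.+2)%N))]. Qed.

Lemma h_nonincreasing j k : (2 <= j)%N -> (j <= k)%N -> h k <= h j.
Proof.
move=> j2; elim: k => [|k IH]; first by rewrite leqn0 => /eqP ->.
rewrite leq_eqVlt => /predU1P[<- //|jk].
exact: le_trans (A1 (leq_trans j2 jk)) (IH jk).
Qed.

(** (A2) multiplied out, a polynomial form suited to [lra] and [nra]. *)
Lemma h_cleared k : (2 <= k)%N -> (k%:R * k%:R - k%:R + 1) * h k <= k%:R.
Proof.
move=> k2; have k2R : 2 <= k%:R :> R by rewrite ler_nat.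
have -> : k%:R * k%:R - k%:R + 1 = k%:R * (k%:R - 1 + 1 / k%:R) :> R by field; lra.
have d0 : 0 < k%:R - 1 + 1 / k%:R :> R.
  by rewrite ltr_pwDr ?divr_gt0 ?subr_ge0 //; lra.
rewrite -mulrA -[leRHS]mulr1 ler_pM2l; last lra.
by rewrite mulrC -ler_pdivlMr //; case/andP: (A2 k2).
Qed.

(** For [k >= 2] this follows from [h_cleared], as [k * k - k + 1 - k] is the square of [k - 1]. *)
Lemma h_le1 k : (0 < k)%N -> h k <= 1.
Proof.
case: k => // -[_|k _]; first by case/andP: h1.
have := h_cleared (isT : (1 < k.+2)%N); set a := k.+2%:R => ha.
have a2 : 2 <= a by rewrite ler_nat.
have : (a * a - a + 1) * (1 - h k.+2) >= 0 by nra.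
rewrite pmulr_rge0 ?subr_ge0 //; nra.
Qed.

(** * Existence of a light edge *)

Lemma supp_gt0 x e : packing x -> e \in supp x -> 0 < x e /\ (0 < #|e|)%N.
Proof.
case=> x0 xge _; rewrite inE => xe; split; first by rewrite lt_def xe xge.
by rewrite card_gt0; apply: contraNneq xe => ->; rewrite x0.
Qed.

Lemma weight_ge0 x e : packing x -> 0 <= h #|e| * x e.
Proof.
move=> px; have [->|xe] := eqVneq (x e) 0; first by rewrite mulr0.
have [|x_gt0 e_gt0] := @supp_gt0 x e px; first by rewrite inE.
by rewrite mulr_ge0 ?h_ge0 // ltW.
Qed.

Lemma weighted_degree_le1 x v :
  packing x -> \sum_(f : {set V} | v \in f) h #|f| * x f <= 1.
Proof.
move=> px; case: (px) => _ xge xv; apply: le_trans (xv v); apply: ler_sum => f vf.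
by apply: ler_piMl => //; apply/h_le1/card_gt0P; exists v.
Qed.

(* A vertex of [e] is counted once for each edge through it, so [e] itself is
   counted [#|e|] times on the right-hand side. *)
Lemma neighbourhood_le x e : packing x ->
  \sum_(f : {set V} | f :&: e != set0) h #|f| * x f + (#|e|%:R - 1) * (h #|e| * x e)
    <= \sum_(v in e) \sum_(f : {set V} | v \in f) h #|f| * x f.
Proof.
move=> px; rewrite (exchange_big_dep (fun f => f :&: e != set0)) /=; last first.
  by move=> v f ve vf; apply/set0Pn; exists v; rewrite inE vf.
have [->|e0] := eqVneq e set0.
  by case: px => x0 _ _; rewrite x0 !mulr0 addr0 ler_sum // => f; rewrite setI0 eqxx.
have ee : e :&: e != set0 by rewrite setIid.
under [leRHS]eq_bigr do rewrite sumr_const -mulr_natl.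
rewrite (bigD1 e) //= [leRHS](bigD1 e) //= addrAC lerD //.
  have -> : #|[pred v in e | v \in e]| = #|e| by apply: eq_card => v; rewrite !inE andbb.
  lra.
apply: ler_sum => f /andP[fe _]; rewrite ler_peMl ?weight_ge0 // ler1n.
by case/set0Pn: fe => v; rewrite inE => /andP[vf ve]; apply/card_gt0P; exists v; apply/andP.
Qed.

Lemma light_edge x : packing x -> independent x -> supp x != set0 ->
  exists2 e, e \in supp x & \sum_(f : {set V} | f :&: e != set0) h #|f| * x f <= 1.
Proof.
move=> px ind /set0Pn[e0 e0s]; apply: contrapT => no_light.
have heavy e : e \in supp x -> 1 < \sum_(f : {set V} | f :&: e != set0) h #|f| * x f.
  by move=> es; rewrite ltNge; apply/negP => le1; apply: no_light; exists e.
have [e1 e1s min_e1] := @arg_minnP _ e0 (mem (supp x)) (fun e => #|e|) e0s.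
have {}e1s : e1 \in supp x := e1s.
set k := #|e1| in min_e1.
have [x_ge0 x_deg] : (forall e, 0 <= x e) /\ (forall v, \sum_(e : {set V} | v \in e) x e <= 1).
  by case: px.
(* A singleton edge of the support is light: the sets meeting it are those through its vertex, where
   the weighted degree is at most 1. *)
have k2 : (2 <= k)%N.
  rewrite ltn_neqAle eq_sym (proj2 (supp_gt0 px e1s)) andbT; apply/negP => /cards1P[v e1v].
  have := heavy _ e1s; rewrite e1v ltNge => /negP; apply.
  rewrite (eq_bigl (fun f : {set V} => v \in f)) ?weighted_degree_le1 // => f.
  by rewrite setI_eq0 disjoint_sym disjoints1 negbK.
pose E := [set e in supp x | #|e| == k].
pose d v := \sum_(e in E | v \in e) x e.
have EP e : e \in E -> [/\ e \in supp x, 0 < x e & #|e| = k].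
  by rewrite inE => /andP[es /eqP ek]; split=> //; case: (supp_gt0 px es).
have degE v (F : {set V} -> R) : \sum_(f : {set V} | v \in f) F f =
    \sum_(f in E | v \in f) F f + \sum_(f : {set V} | (v \in f) && (f \notin E)) F f.
  by rewrite (bigID (mem E)) /=; congr (_ + _); apply: eq_bigl => f; rewrite andbC.
have d_le1 v : d v <= 1.
  by apply: le_trans (x_deg v); rewrite degE lerDl sumr_ge0.
(* Support edges outside [E] have size at least [k + 1], and their total [x]-weight at [v] is at
   most [1 - d v]. *)
have a_le v : \sum_(f : {set V} | v \in f) h #|f| * x f <= h k * d v + h k.+1 * (1 - d v).
  rewrite degE lerD //.
    rewrite mulr_sumr ler_sum // => f /andP[/EP[_ _ ->]] //.
  apply: (@le_trans _ _ (h k.+1 * \sum_(f : {set V} | (v \in f) && (f \notin E)) x f)).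
    rewrite mulr_sumr; apply: ler_sum => f /andP[_ fE].
    have [->|xf] := eqVneq (x f) 0; first by rewrite !mulr0.
    have fs : f \in supp x by rewrite inE.
    rewrite ler_wpM2r // h_nonincreasing //; first exact: leqW.
    by rewrite ltn_neqAle min_e1 // andbT eq_sym; move: fE; rewrite inE fs.
  by rewrite ler_wpM2l ?h_ge0 // lerBrDl -degE.
have tight e : e \in E -> \sum_(v in e) (1 - d v + x e) < 1.
  move=> /EP[es xe ek].
  have := neighbourhood_le e px.
  have := heavy e es.
  have := @ler_sum _ _ (index_enum V) (mem e) _ _ (fun v _ => a_le v).
  move: (\sum_(v in e) \sum_(f : {set V} | v \in f) _) => a.
  move: (\sum_(f : {set V} | f :&: e != set0) _) => n.
  have -> : \sum_(v in e) (h k * d v + h k.+1 * (1 - d v)) =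
      h k * k%:R - (h k - h k.+1) * \sum_(v in e) (1 - d v).
    rewrite mulr_natr -ek -sumr_const mulr_sumr -sumrB; apply: eq_bigr => v _; ring.
  have -> : \sum_(v in e) (1 - d v + x e) = \sum_(v in e) (1 - d v) + k%:R * x e.
    by rewrite big_split /= sumr_const ek -[x e *+ _]mulr_natl.
  rewrite ek.
  have : 0 <= \sum_(v in e) (1 - d v) by rewrite sumr_ge0 // => v _; rewrite subr_ge0.
  move: (\sum_(v in e) _) => Y Y0 le_a n_gt1 n_le.
  have k2R : 2 <= k%:R :> R by rewrite ler_nat.
  have := A1 k2; have := A3 k2; have := h_cleared k2; have := h_ge0 (ltnW k2).
  move: (h k) (h k.+1) (k%:R) k2R le_a n_le => hk hk' K K2 le_a n_le hk0 hkK hk3 hk1.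
  (* Heaviness now gives [(K - 1) * (hk * x e) + (hk - hk') * Y < K * hk - 1]. Both terms on the
     left are nonnegative, so [K * hk - 1] is positive and can be cancelled at the end. *)
  have p1 : 0 <= (K - 1) * (hk * x e) by rewrite !mulr_ge0 ?subr_ge0 // ltW //; lra.
  have p2 : 0 <= (hk - hk') * Y by rewrite mulr_ge0 // subr_ge0.
  (* (A3) says [K * hk - 1 <= hk - hk'] and (A2) says
     [K * (K * hk - 1) <= (K - 1) * hk]. *)
  have c0 : 0 < K * hk - 1 by lra.
  have cY : (K * hk - 1) * Y <= (hk - hk') * Y by rewrite ler_wpM2r //; lra.
  have cx : (K * (K * hk - 1)) * x e <= ((K - 1) * hk) * x e by rewrite ler_wpM2r //; lra.
  have : 0 < (K * hk - 1) * (1 - (Y + K * x e)) by lra.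
  by rewrite pmulr_rgt0 // subr_gt0.
have /kernel_of_card[z zN0 [zE zU]] : (#|cover E| < #|E|)%N.
  rewrite -(ltr_nat R) -!sum1_card !natr_sum /=.
  apply: (@le_lt_trans _ _ (\sum_(e in E) \sum_(v in e) (1 - d v + x e))); last first.
    (* Strictness of the sum needs [E] to be nonempty; [e1] is a member. *)
    apply: ltr_sum => //; apply/hasP; exists e1; rewrite ?mem_index_enum //.
    by rewrite inE e1s eqxx.
  rewrite (exchange_big_dep (mem (cover E))) /=; last first.
    by move=> e v eE ve; apply/bigcupP; exists e.
  (* If [m >= 1] edges of [E] contain [v], its contribution is [m * (1 - d v) + d v], which is at
     least 1. *)
  apply: ler_sum => v /bigcupP[e eE ve].
  rewrite big_split /= -/(d v) (bigD1 e) /=; last by rewrite eE.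
  rewrite addrAC subrK lerDl sumr_ge0 // => f _; by rewrite subr_ge0.
case/eqP: zN0; apply: ind; split=> [e xe|v].
  by apply: zE; apply/negP => /EP[_]; rewrite xe ltxx.
(* A vertex outside [cover E] lies on no edge of [E], so its sum vanishes termwise. *)
have [/zU //|vU] := boolP (v \in cover E).
rewrite big1 // => e ve; apply: zE; apply: contraNN vU => eE.
by apply/bigcupP; exists e.
Qed.

(** * Random matchings with exact marginals *)

Definition matching_law (x : {ffun {set V} -> R}) (p : {ffun {set {set V}} -> R}) :=
  [/\ forall M, 0 <= p M,
      forall M, p M != 0 -> trivIset M && (M \subset supp x),
      \sum_M p M = 1
    & forall e, pr_edge p e = h #|e| * x e].

Lemma matching_law_convex x y1 y2 p1 p2 t : 0 < t < 1 ->
  supp y1 \subset supp x -> supp y2 \subset supp x ->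
  (forall e, x e = t * y1 e + (1 - t) * y2 e) ->
  matching_law y1 p1 -> matching_law y2 p2 ->
  matching_law x [ffun M => t * p1 M + (1 - t) * p2 M].
Proof.
move=> /andP[t0 t1] s1 s2 xE [p1_ge0 p1M p1_1 p1e] [p2_ge0 p2M p2_1 p2e].
split=> [M|M||e].
- by rewrite ffunE addr_ge0 // mulr_ge0 // ?subr_ge0 ltW.
- rewrite ffunE; have [->|/p1M/andP[-> sM] _] := eqVneq (p1 M) 0; last exact: subset_trans s1.
  have [->|/p2M/andP[-> sM] _] := eqVneq (p2 M) 0; last exact: subset_trans s2.
  by rewrite !mulr0 addr0 eqxx.
- under eq_bigr do rewrite ffunE.
  by rewrite big_split /= -!mulr_sumr p1_1 p2_1 !mulr1 subrKC.
- rewrite /pr_edge; under eq_bigr do rewrite ffunE.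
  rewrite big_split /= -!mulr_sumr [X in t * X]p1e [X in (1 - t) * X]p2e xE; ring.
Qed.

Lemma matching_law_empty x : supp x = set0 -> matching_law x [ffun M => (M == set0)%:R].
Proof.
move=> sx0; have x0 e : x e = 0.
  by apply/eqP; move/setP/(_ e): sx0; rewrite !inE => /negbFE.
split=> [M|M||e].
- by rewrite ffunE ler0n.
- rewrite ffunE; have [->|_] := eqVneq M set0; last by rewrite eqxx.
  by rewrite sub0set andbT => _; apply/trivIsetP => A B; rewrite inE.
- under eq_bigr do rewrite ffunE.
  by rewrite (bigD1 set0) //= eqxx big1 ?addr0 // => M /negbTE ->.
- rewrite x0 mulr0 /pr_edge big1 // => M eM; rewrite ffunE; case: eqP => // M0.
  by rewrite M0 inE in eM.
Qed.

Definition drop_edge x e : {ffun {set V} -> R} := [ffun f => if f == e then 0 else x f].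

Lemma packing_drop x e : packing x -> packing (drop_edge x e).
Proof.
case=> x0 x_ge0 x_deg; split=> [|f|v].
- by rewrite ffunE x0; case: ifP.
- by rewrite ffunE; case: ifP.
- by apply: le_trans (x_deg v); apply: ler_sum => f _; rewrite ffunE; case: ifP.
Qed.

Lemma supp_drop x e : supp (drop_edge x e) = supp x :\ e.
Proof. by apply/setP => f; rewrite !inE ffunE; case: (f == e); rewrite ?eqxx. Qed.

Lemma matching_law_add x e p : packing x -> e \in supp x ->
  \sum_(f : {set V} | f :&: e != set0) h #|f| * x f <= 1 ->
  matching_law (drop_edge x e) p -> exists q, matching_law x q.
Proof.
move=> px es light [p_ge0 pM p_1 pe].
pose free (M : {set {set V}}) := [forall f in M, f :&: e == set0].
pose Q := \sum_(M | free M) p M.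
have ee : e :&: e != set0.
  by rewrite setIid -card_gt0; case: (supp_gt0 px es).
have g_ge0 := weight_ge0 e px.
have gQ : h #|e| * x e <= Q.
  have QC : Q = 1 - \sum_(M | ~~ free M) p M.
    by rewrite -p_1 (bigID free) /= addrK.
  rewrite QC lerBrDr -lerBrDl.
  (* Union bound over the sets meeting [e]. Exact marginals bound it from above; the term of [e]
     itself is 0, which leaves room for [h #|e| * x e] in the lightness bound. *)
  apply: (@le_trans _ _ (\sum_(f : {set V} | f :&: e != set0) pr_edge p f)); last first.
    rewrite lerBrDl; apply: le_trans light.
    rewrite [leRHS](bigD1 e) //= lerD2l (bigD1 e) //= pe ffunE eqxx mulr0 add0r.
    by apply: ler_sum => f /andP[_ /negbTE fe]; rewrite pe ffunE fe.
  rewrite /pr_edge (exchange_big_dep xpredT) //= [leRHS](bigID free) /=.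
  rewrite ler_wpDl ?sumr_ge0 // => [M _|]; first by rewrite sumr_ge0.
  apply: ler_sum => M; rewrite negb_forall => /existsP[f].
  rewrite negb_imply => /andP[fM fe].
  by rewrite (bigD1 f) /= ?fe // lerDl sumr_ge0.
(* The conditional probability of adding [e]; it is 0 when [Q = 0], by [0 / 0 = 0]. *)
pose l := h #|e| * x e / Q.
have l_ge0 : 0 <= l by rewrite divr_ge0 // (le_trans _ gQ).
have l_le1 : l <= 1.
  have [Q0|Q0] := eqVneq Q 0; first by rewrite /l Q0 invr0 mulr0.
  by rewrite ler_pdivrMr ?mul1r // lt_def Q0 (le_trans _ gQ).
have lQ : l * Q = h #|e| * x e.
  have [Q0|Q0] := eqVneq Q 0; last by rewrite divfK.
  by rewrite Q0 mulr0; apply/eqP; rewrite eq_le g_ge0 -Q0 gQ.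
pose b M : R := l * (free M)%:R.
have b_ge0 M : 0 <= b M by rewrite mulr_ge0 ?ler0n.
have b_le1 M : b M <= 1 by rewrite /b; case: (free M); rewrite ?mulr1 ?mulr0.
(* The law of [M] after [e] is added with conditional probability [b M]. *)
pose q : {ffun {set {set V}} -> R} := [ffun N => \sum_M
  p M * ((1 - b M) * (N == M)%:R + b M * (N == e |: M)%:R)].
(* Probability of an event under [q] by conditioning on [M]; it yields both the total mass and the
   marginals. *)
have qE (P : pred {set {set V}}) : \sum_(N | P N) q N =
    \sum_M p M * ((1 - b M) * (P M)%:R + b M * (P (e |: M))%:R).
  have indic M : \sum_(N | P N) (N == M)%:R = (P M)%:R :> R.
    case: (boolP (P M)) => PM.
      by rewrite (bigD1 M) //= eqxx big1 ?addr0 // => N /andP[_ /negbTE ->].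
    by rewrite big1 // => N PN; case: eqP => // NM; rewrite -NM PN in PM.
  under eq_bigr do rewrite ffunE.
  rewrite exchange_big /=; apply: eq_bigr => M _.
  by rewrite -mulr_sumr big_split /= -!mulr_sumr !indic.
exists q; split=> [N|N||f].
- by rewrite ffunE sumr_ge0 // => M _; apply: mulr_ge0 => //; apply: addr_ge0; apply: mulr_ge0; rewrite ?subr_ge0 ?ler0n.
- rewrite ffunE => qN; have [M] : exists M,
      p M * ((1 - b M) * (N == M)%:R + b M * (N == e |: M)%:R) != 0.
    apply/existsP; apply: contraNT qN => /existsPn all0.
    by rewrite big1 // => M _; apply/eqP; have := all0 M; rewrite negbK.
  rewrite mulf_eq0 negb_or => /andP[/pM/andP[triv]].
  rewrite supp_drop subsetD1 => /andP[sM eM].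
  have [->|_] := eqVneq N M; first by rewrite triv sM.
  have [->|_] := eqVneq N (e |: M); last by rewrite !mulr0 addr0 eqxx.
  rewrite /b; case: (boolP (free M)) => [/forall_inP fM _|_]; last by rewrite !mulr0 mul0r addr0 eqxx.
  rewrite subUset sub1set es sM !andbT.
  have dis f : f \in M -> [disjoint f & e] by move=> /fM; rewrite setI_eq0.
  apply/trivIsetP => A B /setU1P[->|AM] /setU1P[->|BM] AB.
  + by rewrite eqxx in AB.
  + by rewrite disjoint_sym dis.
  + exact: dis.
  + exact: (trivIsetP triv).
- by rewrite (qE xpredT) -[RHS]p_1; apply: eq_bigr => M _; rewrite !mulr1 subrK mulr1.
- rewrite /pr_edge (qE (fun N : {set {set V}} => f \in N)).
  have [->|fe] := eqVneq f e.
    (* Under [p], [M] almost surely omits [e], so [e] is present only when added, with probability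
       [l * Q]. *)
    rewrite -lQ mulr_sumr [RHS]big_mkcond /=; apply: eq_bigr => M _.
    rewrite setU11 /b; have [->|/pM/andP[_]] := eqVneq (p M) 0.
      by rewrite mul0r; case: ifP; rewrite ?mulr0.
    rewrite supp_drop subsetD1 => /andP[_ /negbTE ->].
    by case: (free M); rewrite /= ?mulr0 ?mulr1 ?add0r ?mulr0 // mulrC.
  transitivity (pr_edge p f); last by rewrite pe ffunE (negbTE fe).
  rewrite /pr_edge [RHS]big_mkcond /=; apply: eq_bigr => M _.
  by rewrite !inE (negbTE fe) /=; case: (f \in M); rewrite /= ?mulr0 ?mulr1 ?addr0 ?subrK ?mulr0 ?mulr1.
Qed.

Lemma matching_law_exists x : packing x -> exists p, matching_law x p.
Proof.
have [n] := ubnP #|supp x|; elim: n x => // n IH x.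
rewrite ltnS => xn px.
case: (independent_or_split px) => [ind|[y1 [y2 [t [t01 [py1 py2] [s1 s2] xE]]]]].
  have [sx0|sx0] := eqVneq (supp x) set0.
    by exists [ffun M => (M == set0)%:R]; apply: matching_law_empty.
  have [e es light] := light_edge px ind sx0.
  have [|p] := IH (drop_edge x e) _ (packing_drop e px); last exact: matching_law_add.
  rewrite supp_drop; apply: leq_trans xn.
  by rewrite [leqRHS](cardsD1 e) es.
have [p1 law1] := IH y1 (leq_trans (proper_card s1) xn) py1.
have [p2 law2] := IH y2 (leq_trans (proper_card s2) xn) py2.
exists [ffun M => t * p1 M + (1 - t) * p2 M].
exact: (matching_law_convex t01 (proper_sub s1) (proper_sub s2) xE law1 law2).
Qed.

(** * Back to fractional matchings of a hypergraph *)

Lemma fractional_matchingP (H : hypergraph V) x :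
  fractional_matching H x <-> packing x /\ supp x \subset edges H.
Proof.
have restrict v : (forall e, e \notin edges H -> x e = 0) ->
    \sum_(e : {set V} | v \in e) x e = \sum_(e in edges H | v \in e) x e.
  move=> xN; rewrite (bigID (mem (edges H))) /= [X in _ + X]big1 ?addr0.
    by apply: eq_bigl => e; rewrite andbC.
  by move=> e /andP[_ /xN].
split=> [[xN x01 x_deg]|[[x0 x_ge0 x_deg] /subsetP sx]].
  split; first split.
  - exact/xN/edges_nonempty.
  - by move=> e; case: (boolP (e \in edges H)) => [/x01/andP[]|/xN ->].
  - by move=> v; rewrite restrict.
  by apply/subsetP => e; rewrite inE; apply: contraR => /xN ->.
have xN e : e \notin edges H -> x e = 0.
  by move=> eH; apply: contraNeq eH => xe; apply: sx; rewrite inE.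
split=> // [e eH|v]; last by rewrite -restrict.
(* The bound [x e <= 1] follows from the constraint at any vertex of [e]. *)
rewrite x_ge0 /=; have [e0|[v ve]] := set_0Vmem e.
  by have := edges_nonempty H; rewrite -e0 eH.
by apply: le_trans (x_deg v); rewrite (bigD1 e) //= lerDl sumr_ge0.
Qed.

(** A split would stay inside the polytope, so extremality would equate [x] with a packing of
    smaller support. *)
Lemma basic_independent (H : hypergraph V) x :
  basic_fractional_matching H x -> independent x.
Proof.
case=> /fractional_matchingP[px sx] ext.
case: (independent_or_split px) => // -[y1 [y2 [t [t01 [py1 py2] [s1 s2] xE]]]].
have fm y : packing y -> supp y \proper supp x -> fractional_matching H y.
  move=> py /proper_sub sy; apply/fractional_matchingP; split=> //; exact: subset_trans sx.
have [y1x _] := ext y1 y2 t (fm _ py1 s1) (fm _ py2 s2) t01 xE.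
by rewrite y1x properxx in s1.
Qed.

Lemma good_size (H : hypergraph V) : good H (fun e : {set V} => h #|e|).
Proof.
move=> H' _ /set0Pn[e0 e0H] [x [bx stuck_x]].
have [px sx] := (fractional_matchingP H' x).1 bx.1.
have xN e : e \notin edges H' -> x e = 0.
  by move=> eH; apply: contraNeq eH => xe; apply: (subsetP sx); rewrite inE.
(* Moving the term of [e] across the stuck inequality makes it the negation of lightness. *)
have closed e : e \in supp x -> \sum_(f in nbhd H' e) h #|f| * x f + h #|e| * x e =
    \sum_(f : {set V} | f :&: e != set0) h #|f| * x f.
  move=> es; have [_ e_gt0] := supp_gt0 px es.
  rewrite [RHS](bigD1 e) /= ?setIid -?card_gt0 // addrC; congr (_ + _).
  rewrite [RHS](bigID (mem (edges H'))) /= [X in _ = _ + X]big1 ?addr0.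
    by apply: eq_bigl => f; rewrite inE; case: (f \in edges H'); rewrite /= ?andbT ?andbF // andbC.
  by move=> f /andP[_ /xN ->]; rewrite mulr0.
(* For [x = 0] the stuck inequality at [e0] reads [0 > 1]. *)
have [sx0|sx0] := eqVneq (supp x) set0.
  have x0 e : x e = 0 by apply/eqP; move/setP/(_ e): sx0; rewrite !inE => /negbFE.
  have := stuck_x _ e0H; rewrite x0 mulr0 subr0 big1 ?ltr10 // => f _.
  by rewrite x0 mulr0.
have [e es] := light_edge px (basic_independent bx) sx0.
by rewrite -closed // leNgt -ltrBlDr stuck_x // (subsetP sx).
Qed.

Lemma matching_distribution_exists (H : hypergraph V) x : fractional_matching H x ->
  exists p, matching_distribution H p /\ forall e, pr_edge p e = h #|e| * x e.
Proof.
move=> /fractional_matchingP[px sx]; have [p [p_ge0 pM p_1 pe]] := matching_law_exists px.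
exists p; split=> //; split=> // M; apply: contraNeq => /pM/andP[triv sM].
by rewrite /matching triv (subset_trans sM sx).
Qed.

End Packings.

Theorem theorem10 (R : realType) (h : nat -> R)
  (h1 : 0 <= h 1%N <= 1)
  (A1 : forall k : nat, (2 <= k)%N -> h k.+1 <= h k)
  (A2 : forall k : nat, (2 <= k)%N -> 0 <= h k <= 1 / (k%:R - 1 + 1 / k%:R))
  (A3 : forall k : nat, (2 <= k)%N -> h k.+1 <= 1 - (k%:R - 1) * h k) :
  (forall (V : finType) (H : hypergraph V), good H (fun e : {set V} => h #|e|))
  /\
  (forall (V : finType) (H : hypergraph V) (x : {ffun {set V} -> R}),
     fractional_matching H x ->
     exists p : {ffun {set {set V}} -> R},
       matching_distribution H p /\
       forall e : {set V}, e \in edges H -> pr_edge p e >= h #|e| * x e).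
Proof.
split=> [V H|V H x /(matching_distribution_exists h1 A1 A2 A3)[p [pd pe]]].
  exact: good_size.
by exists p; split=> // e _; rewrite pe.
Qed.
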